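(* Let $n\ge3$ and let $(\mathfrak g,H=0,\mathcal G_g)$ be an $n$-dimensional almost Abelian generalised Lorentzian Lie algebra with non-degenerate codimension one Abelian ideal $\mathfrak n$, let $X\in\mathfrak n^\perp$ with $g(X,X)\in\{-1,1\}$ and $f:=\mathrm{ad}_X|_{\mathfrak n}\in\mathrm{End}(\mathfrak n)$. Suppose that one of the following holds: (a) $\mathfrak n$ is positive definite and, with respect to some orthonormal basis of $\mathfrak n$, $f=\mathrm{diag}(L_1(0,a_1),\dots,L_1(0,a_k),0,\dots,0)$ for some $k\in\{0,\dots,\lfloor\frac{n-1}2\rfloor\}$ and $a_1\ge\dots\ge a_k>0$; (b) $\mathfrak n$ is Lorentzian and with respect to some orthonormal basis $(e_1,\dots,e_{n-1})$ of $\mathfrak n$ with $g(e_1,e_1)=-1$ one of the following holds: (i) $n=3$ and $f=\begin{pmatrix}0&\rho\\ \rho&0\end{pmatrix}$ for some $\rho\in\mathbb R$; (ii) $n$ is even and $f=\mathrm{diag}(M_3(\sigma),L_1(0,a_1),\dots,L_1(0,a_k),0,\dots,0)$ for some $\sigma\in\mathbb R$, $k\in\{0,\dots,\frac{n-4}2\}$, $a_1\ge\dots\ge a_k>0$; (iii) $n\ge5$ is odd and $f=\mathrm{diag}(M_4(\sigma,\tau),L_1(0,a_1),\dots,L_1(0,a_k),0,\dots,0)$ for some $\sigma\in\mathbb R$, $\tau\ge0$, $k\in\{0,\dots,\frac{n-5}2\}$, $a_1\ge\dots\ge a_k>0$. Let $\delta\in E^*=(\mathfrak g\oplus\mathfrak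 g^* )^*$ be arbitrary. Then $(\mathfrak g,H=0,\mathcal G_g,\delta)$ is generalised Einstein if and only if $\delta(\mathrm{Im}(f)\oplus\mathrm{Im}(f)^\flat)=0$.
   Context: Let $\mathfrak g$ be a finite-dimensional real Lie algebra. A generalised pseudo-Riemannian metric on $\mathfrak g$ is a pair $(H,\mathcal G_g)$ where $H\in\Lambda^3\mathfrak g^*$ is closed for the Chevalley–Eilenberg differential (normalised by $d\alpha(X,Y)=-\alpha([X,Y])$), $g$ is a non-degenerate symmetric bilinear form on $\mathfrak g$, and $\mathcal G_g$ is the endomorphism of $E=\mathfrak g\oplus\mathfrak g^*$ given by $\mathcal G_g(X+\xi)=\xi^\sharp+X^\flat$, with $X^\flat=g(X,\cdot)$ and $\sharp=\flat^{-1}$; it is Lorentzian if $g$ has signature $(n-1,1)$, $n=\dim\mathfrak g$. Let $E_\pm=\{X\pm X^\flat\mid X\in\mathfrak g\}$ be the $\pm1$-eigenspaces of $\mathcal G_g$ and $\pi_\pm=\frac12(\mathrm{id}\pm\mathcal G_g):E\to E_\pm$. The $H$-twisted Dorfman bracket on $E$ is $[X+\xi,Y+\eta]_H=[X,Y]+d\eta(X,\cdot)-d\xi(Y,\cdot)+H(X,Y,\cdot)$. A divergence operator is an element $\delta\in E^*$. For $u\in E_+$, $v\in E_-$ put $\Gamma_u=\pi_+\circ[u,\cdot]_H|_{E_-}:E_-\to E_+$ and $\Gamma_v=\pi_-\circ[v,\cdot]_H|_{E_+}:E_+\to E_-$. The generalised Ricci curvatures of $(\mathcal G_g,\delta)$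 are, by a known result taken here as definition, $\mathcal{RC}^+(v,u)=-\mathrm{tr}(\Gamma_v\circ\Gamma_u)+\delta(\pi_+[v,u]_H)$ and $\mathcal{RC}^-(u,v)=-\mathrm{tr}(\Gamma_v\circ\Gamma_u)+\delta(\pi_-[u,v]_H)$. The quadruple $(\mathfrak g,H,\mathcal G_g,\delta)$ is generalised Einstein if $\mathcal{RC}^+=0$ and $\mathcal{RC}^-=0$ (for all $u\in E_+$, $v\in E_-$). A Lie algebra is almost Abelian if it has a codimension one Abelian ideal. Matrices act on columns of coordinates ($f(e_j)=\sum_if_{ij}e_i$); diag denotes block-diagonal matrices. $$L_1(\alpha,\beta)=\begin{pmatrix}\alpha&-\beta\\ \beta&\alpha\end{pmatrix},\quad M_3(\sigma)=\begin{pmatrix}0&0&-1+\sigma\\0&0&-1-\sigma\\-1+\sigma&1+\sigma&0\end{pmatrix},\quad M_4(\sigma,\tau)=\begin{pmatrix}0&0&-1+\sigma&\tau\\0&0&-1-\sigma&\tau\\-1+\sigma&1+\sigma&0&0\\ \tau&-\tau&0&0\end{pmatrix}.$$ *)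

(* Defs.v *)
From HB Require Import structures.
From mathcomp Require Import all_boot all_order all_algebra.
From mathcomp Require Import reals.

Set Implicit Arguments.
Unset Strict Implicit.
Unset Printing Implicit Defensive.

Import Order.TTheory GRing.Theory Num.Theory.
Local Open Scope ring_scope.

(* The trace does not depend on the basis; [passmx.mxof] acts on row vectors, i.e. it
   is the transpose of the usual matrix of f. *)
Definition lftrace (K : fieldType) (V : vectType K) (f : 'End(V)) : K :=
  \tr (passmx.mxof (vbasis fullv) (vbasis fullv) f).

(* Finite-dimensional real Lie algebras. The bracket is curried, so that its
   bilinearity is carried by the type: [X, Y] = ad X Y. *)
Record lieAlgebra (R : realType) := LieAlgebra {
  lie_sort :> vectType R;
  ad : 'Hom(lie_sort, 'End(lie_sort));
  ad_alternating : forall X, ad X X = 0;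
  ad_jacobi : forall X Y Z,
    ad X (ad Y Z) + ad Y (ad Z X) + ad Z (ad X Y) = 0
}.

Arguments ad {R l}.

Section Lie.
Context {R : realType} {L : lieAlgebra R}.

Definition dual := 'Hom(L, R^o).

Implicit Types (X Y Z : L) (xi eta : dual).

(* d xi (X, .) = - xi([X, .]) *)
Definition d1 xi X : dual := - (xi \o ad X)%VF.

(* A trilinear form is curried: H X Y Z, and H X Y is the one-form H(X,Y,.). *)
Definition trilinear := 'Hom(L, 'Hom(L, dual)).

Definition alternating3 (H : trilinear) :=
  (forall X Y, H X X Y = 0) /\ (forall X Y, H X Y Y = 0).

(* Chevalley-Eilenberg:
   dH(X0,..,X3) = \sum_(i < j) (-1)^(i+j) H([Xi,Xj], .. ^Xi .. ^Xj ..). *)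
Definition closed3 (H : trilinear) :=
  forall X0 X1 X2 X3,
    - H (ad X0 X1) X2 X3 + H (ad X0 X2) X1 X3 - H (ad X0 X3) X1 X2
    - H (ad X1 X2) X0 X3 + H (ad X1 X3) X0 X2 - H (ad X2 X3) X0 X1 = 0.

Definition codim1_abelian_ideal (N : {vspace L}) :=
  [/\ (\dim N).+1 = \dim {:L},
      forall X Y, Y \in N -> ad X Y \in N &
      forall Y Z, Y \in N -> Z \in N -> ad Y Z = 0].

End Lie.

Arguments dual {R} L.
Arguments trilinear {R} L.

(* The pair (H, g). The metric is curried, so that X^flat is met X. *)
Record genMetric (R : realType) (L : lieAlgebra R) := GenMetric {
  flux : trilinear L;
  flux_alternating : alternating3 flux;
  flux_closed : closed3 flux;
  met : 'Hom(L, dual L);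
  met_sym : forall X Y, met X Y = met Y X;
  met_nondeg : forall X, (forall Y, met X Y = 0) -> X = 0
}.

Section Metric.
Context {R : realType} {L : lieAlgebra R} (G : genMetric L).

Implicit Types (X Y Z : L) (W : {vspace L}).

Definition ip X Y : R := met G X Y.

Definition nondegenerate_on W :=
  forall Y, Y \in W -> (forall Z, Z \in W -> ip Y Z = 0) -> Y = 0.

Definition positive_definite_on W :=
  forall Y, Y \in W -> Y != 0 -> 0 < ip Y Y.

(* signature (p, q): p plus signs and q minus signs *)
Definition signature_on W (p q : nat) :=
  exists e : (p + q).-tuple L, basis_of W e /\
    forall i j, ip (tnth e i) (tnth e j) =
      if i == j then (if (i < p)%N then 1 else -1) else 0.

Definition lorentzian_on W := signature_on W (\dim W).-1 1.

Definition orthonormal_basis W m (e : m.-tuple L) :=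
  [/\ basis_of W e,
      forall i j, i != j -> ip (tnth e i) (tnth e j) = 0 &
      forall i, ip (tnth e i) (tnth e i) = 1 \/
                ip (tnth e i) (tnth e i) = -1].

Definition flat : 'Hom(L, dual L) := met G.
(* a two-sided inverse, since flat is bijective *)
Definition sharp : 'Hom(dual L, L) := (flat^-1)%VF.

Definition gtan : vectType R := (L * dual L)%type.

Definition calG_fun (u : gtan) : gtan := (sharp u.2, flat u.1).

Lemma calG_is_linear : linear calG_fun.
Proof. by move=> a u v; rewrite /calG_fun /= !linearP. Qed.

HB.instance Definition _ :=
  GRing.isSemilinear.Build R gtan gtan _ calG_fun
    (GRing.semilinear_linear calG_is_linear).

Definition calG : 'End(gtan) := linfun calG_fun.

Definition pi_plus : 'End(gtan) := 2^-1 *: (\1 + calG)%VF.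
Definition pi_minus : 'End(gtan) := 2^-1 *: (\1 - calG)%VF.

Definition graph_fun (s : R) X : gtan := (X, s *: flat X).

Lemma graph_is_linear s : linear (graph_fun s).
Proof.
move=> a X Y; rewrite /graph_fun linearP scalerDr scalerA mulrC -scalerA.
by [].
Qed.

HB.instance Definition _ s :=
  GRing.isSemilinear.Build R L gtan _ (graph_fun s)
    (GRing.semilinear_linear (graph_is_linear s)).

Definition E_plus : {vspace gtan} := limg (linfun (graph_fun 1)).
Definition E_minus : {vspace gtan} := limg (linfun (graph_fun (-1))).

Definition dorfman (u v : gtan) : gtan :=
  (ad u.1 v.1, d1 v.2 u.1 - d1 u.2 v.1 + flux G u.1 v.1).

Lemma dorfman_is_linear u : linear (dorfman u).
Proof.
move=> a v w; rewrite /dorfman /d1 /= !linearP /=; congr (_, _).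
rewrite comp_lfunDl comp_lfunDr -comp_lfunZl -comp_lfunZr /=.
rewrite !opprK !opprD !scalerDr !scalerN.
rewrite (addrACA (- _)).
by rewrite [LHS]addrACA.
Qed.

HB.instance Definition _ u :=
  GRing.isSemilinear.Build R gtan gtan _ (dorfman u)
    (GRing.semilinear_linear (dorfman_is_linear u)).

(* [vsproj] is only applied to vectors that already lie in the subspace *)
Definition Gamma_plus (u : gtan) : 'Hom(subvs_of E_minus, subvs_of E_plus) :=
  linfun (vsproj E_plus \o pi_plus \o dorfman u \o vsval).

Definition Gamma_minus (v : gtan) : 'Hom(subvs_of E_plus, subvs_of E_minus) :=
  linfun (vsproj E_minus \o pi_minus \o dorfman v \o vsval).

Definition divergence := 'Hom(gtan, R^o).

Definition RC_plus (delta : divergence) (v u : gtan) : R :=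
  - lftrace (Gamma_minus v \o Gamma_plus u)%VF
  + delta (pi_plus (dorfman v u)).

Definition RC_minus (delta : divergence) (u v : gtan) : R :=
  - lftrace (Gamma_minus v \o Gamma_plus u)%VF
  + delta (pi_minus (dorfman u v)).

Definition generalised_einstein (delta : divergence) :=
  forall u v, u \in E_plus -> v \in E_minus ->
    RC_plus delta v u = 0 /\ RC_minus delta u v = 0.

End Metric.

Arguments gtan {R} L.
Arguments divergence {R} L.

Section Matrices.
Context {R : realType}.

(* columns of A are the coordinates of the images: f e_j = \sum_i A i j e_i *)
Definition matrix_in_basis (V : vectType R) m (e : m.-tuple V) (f : V -> V)
    (A : 'M[R]_m) :=
  forall j, f (tnth e j) = \sum_i A i j *: tnth e i.

Definition mx_of_rows m n (s : seq (seq R)) : 'M[R]_(m, n) :=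
  \matrix_(i, j) nth 0 (nth [::] s i) j.

Definition L1 (alpha beta : R) : 'M[R]_2 := mx_of_rows 2 2
  [:: [:: alpha; - beta];
      [:: beta; alpha]].

Definition M3 (sigma : R) : 'M[R]_3 := mx_of_rows 3 3
  [:: [:: 0; 0; -1 + sigma];
      [:: 0; 0; -1 - sigma];
      [:: -1 + sigma; 1 + sigma; 0]].

Definition M4 (sigma tau : R) : 'M[R]_4 := mx_of_rows 4 4
  [:: [:: 0; 0; -1 + sigma; tau];
      [:: 0; 0; -1 - sigma; tau];
      [:: -1 + sigma; 1 + sigma; 0; 0];
      [:: tau; - tau; 0; 0]].

Definition B2 (rho : R) : 'M[R]_2 := mx_of_rows 2 2
  [:: [:: 0; rho];
      [:: rho; 0]].

(* r is the number of trailing zeros. When the matrix is taken in a basis of N,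
   it is determined by \dim N. *)
Definition rot_diag k (a : 'I_k -> R) (r : nat) :
    'M[R]_(\sum_(i < k) 2 + r) :=
  block_mx (\mxdiag_(i < k) L1 0 (a i)) 0 0 0.

Definition head_rot_diag m (A : 'M[R]_m) k (a : 'I_k -> R) (r : nat) :
    'M[R]_(m + (\sum_(i < k) 2 + r)) :=
  block_mx A 0 0 (rot_diag a r).

Definition pos_nonincreasing k (a : 'I_k -> R) :=
  (forall i, 0 < a i) /\ (forall i j : 'I_k, (i <= j)%N -> a j <= a i).

End Matrices.

(* Main.v *)
(* In all the normal forms [f] is skew with respect to [g] on [N]. Then, for
   [u] over [aX + Y] in [E_+] and [v] over [bX + Z] in [E_-], the Dorfman bracket
   [u, v] is the element of [E_-] over [a f Z] minus the element of [E_+] over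
   [b f Y]. Hence [Gamma_u] takes values over [N], where [Gamma_v] vanishes, and the
   two Ricci curvatures are the values of [delta] on [b f Y] in [E_+] and on
   [a f Z] in [E_-]; these span the sum of [Im f] and [(Im f)^flat]. *)
Require Import Defs.
From mathcomp Require Import all_boot all_order all_algebra.
From mathcomp Require Import reals ring.

Set Implicit Arguments.
Unset Strict Implicit.
Unset Printing Implicit Defensive.

Import Order.TTheory GRing.Theory Num.Theory.
Local Open Scope ring_scope.

Lemma scale_halfD (R : numFieldType) (V : lmodType R) (v : V) :
  2^-1 *: (v + v) = v.
Proof. by rewrite -mulr2n -scaler_nat scalerA mulVf ?pnatr_eq0 // scale1r. Qed.

(** * The metric in an orthogonal basis, skewness and signature *)

Section Metric.
Variables (R : realType) (L : lieAlgebra R) (G : genMetric L).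
Implicit Types (x y z : L) (s t : R) (N : {vspace L}).

Lemma ipC x y : ip G x y = ip G y x.
Proof. exact: met_sym. Qed.

Lemma ipDl x y z : ip G (x + y) z = ip G x z + ip G y z.
Proof. by rewrite /ip linearD add_lfunE. Qed.

Lemma ipZl t x z : ip G (t *: x) z = t * ip G x z.
Proof. by rewrite /ip linearZ scale_lfunE. Qed.

Lemma ipDr x y z : ip G z (x + y) = ip G z x + ip G z y.
Proof. by rewrite /ip linearD. Qed.

Lemma ipZr t x z : ip G z (t *: x) = t * ip G z x.
Proof. by rewrite /ip linearZ. Qed.

Lemma ip_suml I (r : seq I) (F : I -> L) z :
  ip G (\sum_(i <- r) F i) z = \sum_(i <- r) ip G (F i) z.
Proof.
elim/big_rec2: _ => [|i a b _ <-]; last by rewrite ipDl.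
by rewrite -(scale0r (0 : L)) ipZl mul0r.
Qed.

Lemma ip_sumr I (r : seq I) (F : I -> L) z :
  ip G z (\sum_(i <- r) F i) = \sum_(i <- r) ip G z (F i).
Proof. by rewrite ipC ip_suml; apply: eq_bigr => i _; rewrite ipC. Qed.

Lemma ip_coords m (e : m.-tuple L) (c d : 'I_m -> R) :
    (forall i j, i != j -> ip G (tnth e i) (tnth e j) = 0) ->
  ip G (\sum_i c i *: tnth e i) (\sum_i d i *: tnth e i)
    = \sum_i c i * d i * ip G (tnth e i) (tnth e i).
Proof.
move=> e_orth; rewrite ip_suml; apply: eq_bigr => i _.
rewrite ipZl ip_sumr (bigD1 i) //= big1 ?addr0 ?ipZr ?mulrA // => j j_neq_i.
by rewrite ipZr e_orth ?mulr0 // eq_sym.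
Qed.

Lemma basis_coords m (e : m.-tuple L) N y : basis_of N e -> y \in N ->
  exists c : 'I_m -> R, y = \sum_i c i *: tnth e i.
Proof.
move=> /coord_basis e_basis /e_basis ->; exists (fun i => coord e i y).
by apply: eq_bigr => i _; rewrite (tnth_nth 0).
Qed.

Definition skew_on N (f : L -> L) :=
  forall y z, y \in N -> z \in N -> ip G (f y) z = - ip G y (f z).

(** The hypothesis on [A] makes the matrix of the bilinear form [ip (f y) z] in the basis [e]
    antisymmetric; bilinearity carries this over to all of [N]. *)
Lemma skew_on_matrix N m (e : m.-tuple L) (f : 'End(L)) (A : 'M[R]_m) :
    orthonormal_basis G N e -> matrix_in_basis e f A ->
    (forall i j, A i j * ip G (tnth e i) (tnth e i)
               = - (A j i * ip G (tnth e j) (tnth e j))) ->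
  skew_on N f.
Proof.
move=> [e_basis e_orth _] fA A_skew y z.
move=> /(basis_coords e_basis)[c ->] /(basis_coords e_basis)[d ->].
have fE i j : ip G (f (tnth e j)) (tnth e i) = A i j * ip G (tnth e i) (tnth e i).
  rewrite fA ip_suml (bigD1 i) //= big1 ?addr0 ?ipZl // => k k_neq_i.
  by rewrite ipZl e_orth ?mulr0.
rewrite !linear_sum !ip_suml -sumrN; apply: eq_bigr => j _.
rewrite !ip_sumr -sumrN; apply: eq_bigr => i _.
rewrite !linearZ !ipZl !ipZr (ipC (tnth e j)) !fE A_skew; ring.
Qed.

(** Two orthogonal vectors of square -1 would span a negative definite plane, and that plane meets
    the hyperplane of vanishing timelike coordinate, where the metric is nonnegative. *)
Lemma negative_lorentzian N y z : lorentzian_on G N ->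
    y \in N -> z \in N -> ip G y y = -1 -> ip G z z = -1 -> ip G y z != 0.
Proof.
move=> [e [e_basis eE]].
have e_orth i j : i != j -> ip G (tnth e i) (tnth e j) = 0.
  by move=> /negPf ij; rewrite eE ij.
move=> /(basis_coords e_basis)[c ->] /(basis_coords e_basis)[d ->].
set y' := \sum_i _; set z' := \sum_i _ => yy zz; apply/eqP => yz.
(* [signature_on] lists the plus signs first, so the single timelike vector is the last one. *)
pose l : 'I_((\dim N).-1 + 1) := rshift _ ord0.
(* a combination without component along the timelike basis vector *)
pose w := d l *: y' - c l *: z'.
have ww : ip G w w = - (d l ^+ 2 + c l ^+ 2).
  rewrite /w -scaleNr !ipDl !ipDr !ipZl !ipZr (ipC z' y') yy zz yz; ring.
have wE : w = \sum_i (d l * c i - c l * d i) *: tnth e i.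
  rewrite /w !scaler_sumr -sumrB; apply: eq_bigr => i _.
  by rewrite scalerBl !scalerA.
have spacelike (b : 'I_((\dim N).-1 + 1) -> R) : b l = 0 ->
    0 <= ip G (\sum_i b i *: tnth e i) (\sum_i b i *: tnth e i).
  move=> bl0; rewrite ip_coords //; apply: sumr_ge0 => i _; rewrite eE eqxx.
  case: ltnP => [_|l_le_i]; first by rewrite mulr1 -expr2 sqr_ge0.
  have -> : i = l.
    apply/val_inj/eqP; rewrite eqn_leq /= addn0 l_le_i andbT.
    by rewrite -ltnS (leq_trans (ltn_ord i)) ?addn1.
  by rewrite bl0 !mul0r.
have ww_ge0 : 0 <= ip G w w.
  by rewrite wE; apply: spacelike; rewrite mulrC subrr.
(* The square of [w] is nonnegative and also minus a sum of two squares, so both timelike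
   coordinates vanish; then [y'] itself lies in the hyperplane, against its square -1. *)
have /andP[/eqP dl0 /eqP cl0] : (d l == 0) && (c l == 0).
  rewrite -(sqrf_eq0 (d l)) -(sqrf_eq0 (c l)) -paddr_eq0 ?sqr_ge0 //.
  by rewrite eq_le addr_ge0 ?sqr_ge0 // andbT -oppr_ge0 -ww.
by have := spacelike c cl0; rewrite -/y' yy ler0N1.
Qed.

(** An orthonormal basis leaves the signs open. Here the first vector uses up the only minus sign,
    since a second negative vector would be orthogonal to it. *)
Lemma orthonormal_lorentzian N m (e : m.+1.-tuple L) :
    lorentzian_on G N -> orthonormal_basis G N e ->
    ip G (tnth e ord0) (tnth e ord0) = -1 ->
  forall i, ip G (tnth e i) (tnth e i) = if i == ord0 then -1 else 1.
Proof.
move=> N_lor [e_basis e_orth e_unit] e0 i; case: eqP => [-> //|/eqP i_neq0].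
have eN j : tnth e j \in N by rewrite (basis_mem e_basis) ?mem_tnth.
case: (e_unit i) => // ei.
by have := negative_lorentzian N_lor (eN i) (eN ord0) ei e0; rewrite e_orth ?eqxx.
Qed.

Lemma orthonormal_posdef N m (e : m.-tuple L) :
    positive_definite_on G N -> orthonormal_basis G N e ->
  forall i, ip G (tnth e i) (tnth e i) = 1.
Proof.
move=> N_pos [e_basis _ e_unit] i; case: (e_unit i) => // ei.
have eN : tnth e i \in N by rewrite (basis_mem e_basis) ?mem_tnth.
have e_neq0 : tnth e i != 0.
  apply: contra_eq_neq ei => ->.
  by rewrite -(scale0r (0 : L)) ipZl mul0r eq_sym oppr_eq0 oner_eq0.
by have := N_pos _ eN e_neq0; rewrite ei ltr0N1.
Qed.

(** * The eigenspaces of [calG] and their projections *)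

Lemma flatK : cancel (flat G) (sharp G).
Proof.
(* The generic inverse is a left inverse as soon as the kernel is zero, which is nondegeneracy of
   the metric. *)
apply: lker0_lfunK; rewrite -subv0; apply/subvP => x; rewrite memv_ker memv0.
move=> /eqP x0; apply/eqP/(met_nondeg (g := G)) => y.
by rewrite -/(flat G) x0 zero_lfunE.
Qed.

Lemma calG_graph s x : calG G (graph_fun G s x) = (s *: x, flat G x).
Proof. by rewrite lfunE /= /calG_fun /= linearZ /= flatK. Qed.

Lemma pi_plus_graph1 x : pi_plus G (graph_fun G 1 x) = graph_fun G 1 x.
Proof.
by rewrite scale_lfunE add_lfunE id_lfunE calG_graph /graph_fun !scale1r scale_halfD.
Qed.

Lemma pi_plus_graphN1 x : pi_plus G (graph_fun G (-1) x) = 0.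
Proof.
rewrite scale_lfunE add_lfunE id_lfunE calG_graph /graph_fun !scaleN1r.
(* Opposites of pairs are computed componentwise, which exhibits the two summands as opposite. *)
by rewrite -[X in X + _]opprK -[- (x, _)]/(- x, - - _) opprK addNr scaler0.
Qed.

Lemma pi_minusE w : pi_minus G w = w - pi_plus G w.
Proof.
rewrite !scale_lfunE !add_lfunE opp_lfunE id_lfunE.
by rewrite -[X in _ = X - _]scale_halfD -scalerBr opprD addrACA subrr add0r.
Qed.

Lemma pi_minus_graph1 x : pi_minus G (graph_fun G 1 x) = 0.
Proof. by rewrite pi_minusE pi_plus_graph1 subrr. Qed.

Lemma pi_minus_graphN1 x :
  pi_minus G (graph_fun G (-1) x) = graph_fun G (-1) x.
Proof. by rewrite pi_minusE pi_plus_graphN1 subr0. Qed.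

Lemma graph_fun0 s : graph_fun G s 0 = 0.
Proof. by rewrite /graph_fun linear0 scaler0. Qed.

Lemma mem_graph s x : graph_fun G s x \in limg (linfun (graph_fun G s)).
Proof. by rewrite -[graph_fun G s x]lfunE memv_img ?memvf. Qed.

Lemma limg_graphP s u :
  u \in limg (linfun (graph_fun G s)) -> exists x, u = graph_fun G s x.
Proof. by move=> /memv_imgP[x _ ->]; exists x; rewrite lfunE. Qed.

End Metric.

(** * Brackets and Ricci curvatures when [ad X] is skew on [N] *)

Section SkewAlmostAbelian.
Variables (R : realType) (L : lieAlgebra R) (G : genMetric L).
Variables (N : {vspace L}) (X : L).
Hypotheses (H0 : flux G = 0) (N_ideal : codim1_abelian_ideal N).
Hypotheses (X_orth : forall y, y \in N -> ip G X y = 0) (X_unit : ip G X X != 0).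
Hypothesis f_skew : skew_on G N (ad X).
Implicit Types (x y z : L) (a b t : R).

(** [X] is orthogonal to [N] but not to itself, hence lies outside [N]; as [N] has codimension one,
    [N] and [X] span everything. *)
Lemma decomposition x : exists a y, y \in N /\ x = a *: X + y.
Proof.
case: N_ideal => dimN _ _.
have XN : X \notin N by apply: contra X_unit => /X_orth ->.
have full : (N + <[X]> == fullv)%VS.
  rewrite eqEdim subvf -dimN dimv_disjoint_sum ?dim_vline.
    have -> : X != 0 by apply: contraNneq XN => ->; rewrite mem0v.
    by rewrite addn1 leqnn.
  apply/eqP; rewrite -subv0; apply/subvP => y; rewrite memv_cap memv0.
  move=> /andP[yN /vlineP[a yE]]; move: yN; rewrite yE.
  by case: (eqVneq a 0) => [->|a_neq0]; rewrite ?scale0r // rpredZeq (negPf a_neq0) (negPf XN).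
have /memv_addP[y yN [w /vlineP[a ->] ->]] : x \in (N + <[X]>)%VS.
  by rewrite (eqP full) memvf.
by exists a, y; rewrite addrC.
Qed.

Lemma ad_N y : y \in N -> ad X y \in N.
Proof. by case: N_ideal => _ + _; apply. Qed.

Lemma adC x y : ad x y = - ad y x.
Proof.
apply/eqP; rewrite -addr_eq0; apply/eqP.
have := ad_alternating (x + y); rewrite !linearD /= !add_lfunE.
by rewrite !ad_alternating add0r addr0 addrC.
Qed.

Lemma ad_decomposition a b y z : y \in N -> z \in N ->
  ad (a *: X + y) (b *: X + z) = a *: ad X z - b *: ad X y.
Proof.
case: N_ideal => _ _ abel yN zN.
rewrite !linearD !linearZ /= !add_lfunE !scale_lfunE ad_alternating (abel y z) //=.
by rewrite (adC y X) scaler0 add0r addr0 addrC.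
Qed.

(** The parameter [t] covers both orders of the arguments: [t = -1] brackets [E_+] with [E_-], and
    [t = 1] brackets [E_-] with [E_+]. *)
Lemma dorfman_graph t a b y z : y \in N -> z \in N ->
  dorfman G (graph_fun G (- t) (a *: X + y)) (graph_fun G t (b *: X + z))
    = graph_fun G t (a *: ad X z) - graph_fun G (- t) (b *: ad X y).
Proof.
move=> yN zN; rewrite /dorfman /graph_fun /=; congr (_, _).
  by rewrite ad_decomposition.
(* The one-forms are compared on a general vector [c *: X + w]: orthogonality of [X] to [N] removes
   the mixed terms, and skewness moves [ad X] off [w]. *)
apply/lfunP => x; have [c [w [wN ->]]] := decomposition x.
rewrite H0 /d1 !(add_lfunE, opp_lfunE, comp_lfunE, scale_lfunE, zero_lfunE).
rewrite !ad_decomposition // addr0.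
rewrite -/(ip G _ _) /flat -!/(ip G _ _).
rewrite -!scaleN1r !ipDl !ipDr !ipZl !ipZr !X_orth ?ad_N //.
rewrite !(ipC _ (ad X _) X) !X_orth ?ad_N // (f_skew zN wN) (f_skew yN wN).
(* By skewness the terms carrying [c] cancel in pairs. *)
have : ip G z (ad X y) = - ip G y (ad X z) by rewrite ipC f_skew.
rewrite /GRing.scale /= => ->; ring.
Qed.

Lemma dorfman_plus_minus a b y z : y \in N -> z \in N ->
  dorfman G (graph_fun G 1 (a *: X + y)) (graph_fun G (-1) (b *: X + z))
    = graph_fun G (-1) (a *: ad X z) - graph_fun G 1 (b *: ad X y).
Proof.
by move=> yN zN; have := dorfman_graph (-1) a b yN zN; rewrite opprK.
Qed.

Lemma trace_Gamma0 u v : u \in E_plus G -> v \in E_minus G ->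
  lftrace (Gamma_minus G v \o Gamma_plus G u)%VF = 0.
Proof.
move=> /limg_graphP[x ->] /limg_graphP[x' ->].
have [a [y [yN ->]]] := decomposition x.
have [b [z [zN ->]]] := decomposition x'.
suff -> : (Gamma_minus G (graph_fun G (-1) (b *: X + z))
           \o Gamma_plus G (graph_fun G 1 (a *: X + y)))%VF = 0.
  rewrite /lftrace (_ : passmx.mxof _ _ _ = 0) ?mxtrace0 //.
  by apply/eqP; rewrite passmx.mxof_eq0 ?vbasisP.
apply/lfunP => w; rewrite comp_lfunE zero_lfunE !lfunE /=.
have [x'' ->] := limg_graphP (subvsP w).
have [c [z' [z'N ->]]] := decomposition x''.
rewrite dorfman_plus_minus // linearB /= pi_plus_graphN1 pi_plus_graph1 sub0r.
rewrite vsprojK ?rpredN ?mem_graph // linearN /=.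
have cyN : c *: ad X y \in N by rewrite memvZ ?ad_N.
(* The vector [c *: ad X y] has [X]-coefficient 0, so the [E_-] half of the bracket disappears and
   [pi_minus] kills the rest. *)
have := dorfman_graph 1 b 0 zN cyN; rewrite !scale0r add0r => ->.
rewrite graph_fun0 subr0.
by rewrite linearN /= pi_minus_graph1 oppr0 linear0.
Qed.

Lemma RC_plusE delta a b y z : y \in N -> z \in N ->
  RC_plus G delta (graph_fun G (-1) (b *: X + z)) (graph_fun G 1 (a *: X + y))
    = delta (graph_fun G 1 (b *: ad X y)).
Proof.
move=> yN zN; rewrite /RC_plus trace_Gamma0 ?mem_graph // oppr0 add0r.
rewrite dorfman_graph // linearB /= pi_plus_graphN1 pi_plus_graph1.
by rewrite subr0.
Qed.

Lemma RC_minusE delta a b y z : y \in N -> z \in N ->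
  RC_minus G delta (graph_fun G 1 (a *: X + y)) (graph_fun G (-1) (b *: X + z))
    = delta (graph_fun G (-1) (a *: ad X z)).
Proof.
move=> yN zN; rewrite /RC_minus trace_Gamma0 ?mem_graph // oppr0 add0r.
rewrite dorfman_plus_minus // linearB /= pi_minus_graphN1 pi_minus_graph1.
by rewrite subr0.
Qed.

Lemma skew_generalised_einsteinP delta :
  generalised_einstein G delta <->
  (forall y z, y \in (ad X @: N)%VS -> z \in (ad X @: N)%VS ->
     delta (y, flat G z) = 0).
Proof.
split=> [einstein y z /memv_imgP[y' y'N ->] /memv_imgP[z' z'N ->]|delta0 u v].
  (* The test pair is [u] over [x] and [v] over [X]; for [delta_minus] the roles are exchanged. *)
  have delta_plus x : x \in N -> delta (graph_fun G 1 (ad X x)) = 0.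
    move=> xN; have := RC_plusE delta 0 1 xN (mem0v N); rewrite (scale1r (ad X x)) => <-.
    by case: (einstein _ _ (mem_graph G 1 (0 *: X + x))
                           (mem_graph G (-1) (1 *: X + 0))).
  have delta_minus x : x \in N -> delta (graph_fun G (-1) (ad X x)) = 0.
    move=> xN; have := RC_minusE delta 1 0 (mem0v N) xN; rewrite (scale1r (ad X x)) => <-.
    by case: (einstein _ _ (mem_graph G 1 (1 *: X + 0))
                           (mem_graph G (-1) (0 *: X + x))).
  (* [(fy, flat fz)] is the sum of the graph elements over [f(y +- z) / 2] *)
  have -> : (ad X y', flat G (ad X z'))
      = graph_fun G 1 (ad X (2^-1 *: (y' + z')))
        + graph_fun G (-1) (ad X (2^-1 *: (y' - z'))).
    rewrite /graph_fun scale1r scaleN1r !linearZ !linearD !linearN /=.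
    congr (_, _); rewrite -?scalerN -scalerDr.
      by rewrite addrACA subrr addr0 scale_halfD.
    by rewrite opprK addrACA subrr add0r scale_halfD.
  by rewrite linearD /= delta_plus ?delta_minus ?addr0 ?memvZ ?rpredB ?rpredD.
have delta_graph s a x : x \in N -> delta (graph_fun G s (a *: ad X x)) = 0.
  (* Moving the scalars inside turns the graph element into a pair covered by the hypothesis. *)
  by move=> xN; rewrite /graph_fun -!linearZ /= delta0 // memv_img ?memvZ.
move=> /limg_graphP[x ->] /limg_graphP[x' ->].
have [a [y [yN ->]]] := decomposition x.
have [b [z [zN ->]]] := decomposition x'.
by rewrite RC_plusE // RC_minusE // !delta_graph.
Qed.

End SkewAlmostAbelian.

(** * Skewness of the normal forms *)

Section NormalForms.
Variable R : realType.

Lemma L1_skew (b : R) i j : L1 0 b i j = - L1 0 b j i.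
Proof.
by move: i j => [[|[|i]] ?] [[|[|j]] ?] //; rewrite !mxE /= ?oppr0 ?opprK.
Qed.

Lemma rot_diag_skew k (a : 'I_k -> R) r i j :
  rot_diag a r i j = - rot_diag a r j i.
Proof.
suff /matrixP/(_ i j) : rot_diag a r = - (rot_diag a r)^T by rewrite !mxE.
rewrite /rot_diag tr_block_mx opp_block_mx !trmx0 !oppr0; congr block_mx.
rewrite tr_mxdiag -mxdiagN; apply: eq_mxdiag => l.
by apply/matrixP => i' j'; rewrite [RHS]mxE [X in _ = - X]mxE L1_skew.
Qed.

(** The squares of the basis vectors, with the timelike one first, unlike in [signature_on].
    Comparing indices as naturals lets the sign compute on block indices. *)
Definition lorentz_sign m (i : 'I_m) : R := if i == 0 :> nat then -1 else 1.

(** Membership in the Lorentz algebra so(1, m-1), in the form required by [skew_on_matrix]. *)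
Definition lorentz_skew m (A : 'M[R]_m) :=
  forall i j, A i j * lorentz_sign i = - (A j i * lorentz_sign j).

Lemma B2_skew (rho : R) : lorentz_skew (B2 rho).
Proof.
by move=> [[|[|i]] ?] [[|[|j]] ?] //;
  rewrite !mxE /lorentz_sign /=; ring.
Qed.

Lemma M3_skew (s : R) : lorentz_skew (M3 s).
Proof.
by move=> [[|[|[|i]]] ?] [[|[|[|j]]] ?] //;
  rewrite !mxE /lorentz_sign /=; ring.
Qed.

Lemma M4_skew (s t : R) : lorentz_skew (M4 s t).
Proof.
by move=> [[|[|[|[|i]]]] ?] [[|[|[|[|j]]]] ?] //;
  rewrite !mxE /lorentz_sign /=; ring.
Qed.

(** The head is nonempty and so contains the timelike index; on the rotation block all signs are 1
    and the condition is plain antisymmetry. *)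
Lemma head_rot_diag_skew m (A : 'M[R]_m.+1) k (a : 'I_k -> R) r :
  lorentz_skew A -> lorentz_skew (head_rot_diag A a r).
Proof.
move=> A_skew i j; rewrite /head_rot_diag.
have [i' ->|i' ->] := split_ordP i; have [j' ->|j' ->] := split_ordP j.
- by rewrite !block_mxEul; apply: A_skew.
- by rewrite block_mxEur block_mxEdl !mxE !mul0r oppr0.
- by rewrite block_mxEur block_mxEdl !mxE !mul0r oppr0.
- by rewrite !block_mxEdr rot_diag_skew !mulr1.
Qed.

End NormalForms.

Theorem corollary4p23 (R : realType) (n : nat) (n_ge3 : (3 <= n)%N)
    (L : lieAlgebra R) (dimL : \dim {:L} = n)
    (G : genMetric L) (H0 : flux G = 0) (G_lor : lorentzian_on G fullv)
    (N : {vspace L}) (N_ideal : codim1_abelian_ideal N)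
    (N_nondeg : nondegenerate_on G N)
    (X : L) (X_orth : forall Y, Y \in N -> ip G X Y = 0)
    (X_unit : ip G X X = 1 \/ ip G X X = -1)
    (f_normal_form :
      (positive_definite_on G N /\
       exists (k : nat) (a : 'I_k -> R) (r : nat)
              (e : (\sum_(i < k) 2 + r).-tuple L),
         [/\ (k <= n.-1./2)%N, pos_nonincreasing a,
             orthonormal_basis G N e &
             matrix_in_basis e (ad X) (rot_diag a r)])
      \/
      (lorentzian_on G N /\
       [\/ n = 3%N /\
           exists (rho : R) (e : 2.-tuple L),
             [/\ orthonormal_basis G N e,
                 ip G (tnth e ord0) (tnth e ord0) = -1 &
                 matrix_in_basis e (ad X) (B2 rho)],
           ~~ odd n /\
           exists (sigma : R) (k : nat) (a : 'I_k -> R) (r : nat)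
                  (e : (3 + (\sum_(i < k) 2 + r)).-tuple L),
             [/\ (k <= (n - 4)./2)%N, pos_nonincreasing a,
                 orthonormal_basis G N e,
                 ip G (tnth e ord0) (tnth e ord0) = -1 &
                 matrix_in_basis e (ad X) (head_rot_diag (M3 sigma) a r)] |
           [/\ (5 <= n)%N, odd n &
           exists (sigma tau : R) (k : nat) (a : 'I_k -> R) (r : nat)
                  (e : (4 + (\sum_(i < k) 2 + r)).-tuple L),
             0 <= tau /\
             [/\ (k <= (n - 5)./2)%N, pos_nonincreasing a,
                 orthonormal_basis G N e,
                 ip G (tnth e ord0) (tnth e ord0) = -1 &
                 matrix_in_basis e (ad X) (head_rot_diag (M4 sigma tau) a r)]]]))
    (delta : divergence L) :
  generalised_einstein G delta <->
  (forall Y Z, Y \in (ad X @: N)%VS -> Z \in (ad X @: N)%VS ->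
     delta (Y, flat G Z) = 0).
Proof.
have X_unit' : ip G X X != 0.
  by case: X_unit => ->; rewrite ?oppr_eq0 oner_eq0.
suff f_skew : skew_on G N (ad X).
  exact: (skew_generalised_einsteinP H0 N_ideal X_orth X_unit' f_skew).
(* The three Lorentzian normal forms differ only in the matrix whose skewness is supplied. *)
have lorentz_case m (e : m.+1.-tuple L) (A : 'M[R]_m.+1) :
    lorentzian_on G N -> orthonormal_basis G N e ->
    ip G (tnth e ord0) (tnth e ord0) = -1 ->
    matrix_in_basis e (ad X) A -> lorentz_skew A -> skew_on G N (ad X).
  move=> N_lor eN e0 fA A_skew; apply: (skew_on_matrix eN fA) => i j.
  by rewrite !(orthonormal_lorentzian N_lor eN e0); apply: A_skew.
case: f_normal_form => [[N_pos [k [a [r [e [_ _ eN fA]]]]]] | [N_lor]].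
  apply: (skew_on_matrix eN fA) => i j.
  by rewrite !(orthonormal_posdef N_pos eN) !mulr1 rot_diag_skew.
case=> [[_ [rho [e [eN e0 fA]]]] | [_ [s [k [a [r [e [_ _ eN e0 fA]]]]]]] |].
- exact: lorentz_case N_lor eN e0 fA (B2_skew rho).
- have A_skew := @head_rot_diag_skew _ _ _ k a r (M3_skew s).
  (* The size [3 + ...] is presented as the successor of [2 + ...], so that it matches [m.+1]. *)
  exact: (@lorentz_case (2 + (\sum_(i < k) 2 + r))%N e _ N_lor eN e0 fA A_skew).
case=> _ _ [s [t [k [a [r [e [_ [_ _ eN e0 fA]]]]]]]].
have A_skew := @head_rot_diag_skew _ _ _ k a r (M4_skew s t).
exact: (@lorentz_case (3 + (\sum_(i < k) 2 + r))%N e _ N_lor eN e0 fA A_skew).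
Qed.
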